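(* Let $q=p^{2a}$ where $p$ is an odd prime and $a>0$ is an odd integer. If $p\equiv -1\pmod 5$ or $p=5$, then for all integers $t,\ell$ with $0\le t<\ell\le\big\lfloor\frac{q+4\sqrt q-11}{5}\big\rfloor$ there exists a $q$-ary linear locally repairable code with locality $4$ and parameters $$[\,n=5\ell,\ k=4t+1,\ d\ge n-5t-1\,]_q$$ whose Singleton-optimal defect is at most $1$.
   Context: A code $\mathcal{C}\subseteq\mathbb{F}_q^n$ has locality $r$ if for every coordinate $i$ there is a set $I_i\subseteq\{1,\dots,n\}\setminus\{i\}$ with $|I_i|=r$ such that for $a\ne a'$ in $\mathbb{F}_q$ the restrictions to $I_i$ of $\{c\in\mathcal{C}:c_i=a\}$ and $\{c\in\mathcal{C}:c_i=a'\}$ are disjoint. For an $[n,k,d]_q$ code with locality $r$ the Singleton-optimal defect is $\Delta=n-k-\lceil k/r\rceil+2-d\ge0$; optimal means $\Delta=0$, almost optimal means $\Delta=1$. *)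

(* Defs.v *)
From HB Require Import structures.
From mathcomp Require Import all_boot all_order all_algebra all_field.
Set Implicit Arguments. Unset Strict Implicit. Unset Printing Implicit Defensive.
Import GRing.Theory.
Local Open Scope ring_scope.

Definition hdist (F : fieldType) (n : nat) (c c' : 'rV[F]_n) : nat :=
  #|[set j : 'I_n | c ord0 j != c' ord0 j]|.

Definition is_min_dist (F : fieldType) (n : nat) (C : {vspace 'rV[F]_n}) (d : nat) : Prop :=
  (exists c c', [/\ c \in C, c' \in C, c != c' & hdist c c' = d]) /\
  (forall c c', c \in C -> c' \in C -> c != c' -> (d <= hdist c c')%N).

(* Locality r: for every coordinate i there is I_i with i \notin I_i,
   |I_i| = r, such that for a <> a' the restrictions to I_i of
   {c in C : c_i = a} and {c in C : c_i = a'} are disjoint, i.e. two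
   codewords agreeing on I_i agree at i. *)
Definition has_locality (F : fieldType) (n : nat) (C : {vspace 'rV[F]_n}) (r : nat) : Prop :=
  forall i : 'I_n, exists I : {set 'I_n},
    [/\ i \notin I, #|I| = r &
        forall c c', c \in C -> c' \in C -> c ord0 i != c' ord0 i ->
          exists2 j, j \in I & c ord0 j != c' ord0 j].

Definition ceil_div (k r : nat) : nat := (k + r - 1) %/ r.

Definition defect (n k r d : nat) : int :=
  (n%:Z - k%:Z - (ceil_div k r)%:Z + 2 - d%:Z)%R.

(* Main.v *)
(** Let g have degree 5.  On the curve y^2 = g(x) the functions
    sum_j P_j(x) y^j with deg P_j <= 3 restrict on each fibre of y to
    polynomials of degree at most 3 in x, so a fibre made of 5 rational points
    gives locality 4.  Such a function is A(x) + y B(x), and its zeros are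
    counted by the norm A^2 - g B^2, whose degree is its pole order at infinity;
    keeping the monomials of pole order at most 5t + 1 leaves dimension 4t + 1.

    It remains to find a maximal curve of genus 2 over F_q, with q = Q^2.
    If 10 divides Q + 1, take g = X^5 + 1: elements of F_q^* modulo F_Q^* are
    told apart by x |-> x^(Q-1), and the x for which x is a square and 1 - x a
    fifth power are parametrised by pairs of (Q+1)-th roots of unity.
    In characteristic 5, take g = (X^5 - X) / c with c^Q = - c: writing
    y = u + v c with u, v in F_Q, the point y has a full fibre as soon as
    2 c^2 u v is of the form w^5 - w with w in F_Q. *)

Require Import Defs.
From HB Require Import structures.
From mathcomp Require Import all_boot all_order all_algebra all_solvable all_field.
From mathcomp Require Import zify ring.
Set Implicit Arguments. Unset Strict Implicit. Unset Printing Implicit Defensive.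
Import GRing.Theory.
Local Open Scope ring_scope.

(** * Evaluation codes on curves y^2 = g(x) *)

(** Induction on the number of zeros. If (x, y) and (x, -y) with y nonzero both occur, [A] and [B]
    vanish at x; cancelling X - x in each removes two points and lowers the degree of the norm by 2.
    Without such a pair the zeros have distinct abscissas, all of them roots of the norm. *)
Lemma size_curve_zeros (F : fieldType) (g A B : {poly F}) (s : seq (F * F)) :
  2%:R != 0 :> F -> A ^+ 2 - g * B ^+ 2 != 0 -> uniq s ->
  {in s, forall z, g.[z.1] = z.2 ^+ 2 /\ A.[z.1] + z.2 * B.[z.1] = 0} ->
  (size s < size (A ^+ 2 - g * B ^+ 2)%R)%N.
Proof.
move=> two0; have [n] := ubnP (size s); elim: n => // n IHn in s A B *.
move=> lt_s_n N0 s_uniq sP.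
case: (altP (@hasP _ (fun z => ((z.1, - z.2) \in s) && (z.2 != 0)) s)).
  case=> -[x y] /= zs /andP[z's y0].
  have [/= gx ABp] := sP _ zs; have [/= _ ABm] := sP _ z's.
  have Bx : root B x.
    have : 2%:R * y * B.[x] = 0.
      by rewrite -[RHS]subr0 -{1}ABp -[in RHS]ABm; ring.
    by move/eqP; rewrite !mulf_eq0 (negPf two0) (negPf y0).
  have Ax : root A x by rewrite /root -ABp (rootP Bx) mulr0 addr0.
  have [A' defA] := factor_theorem A x Ax.
  have [B' defB] := factor_theorem B x Bx.
  have defN : A ^+ 2 - g * B ^+ 2
      = ('X - x%:P) ^+ 2 * (A' ^+ 2 - g * B' ^+ 2) by rewrite defA defB; ring.
  have N'0 : A' ^+ 2 - g * B' ^+ 2 != 0.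
    by apply: contraNneq N0 => N'0; rewrite defN N'0 mulr0.
  have szN : size (A ^+ 2 - g * B ^+ 2) = (size (A' ^+ 2 - g * B' ^+ 2)).+2.
    by rewrite defN size_monicM ?monic_exp ?monicXsubC // size_exp_XsubC.
  pose s' := rem (x, - y) (rem (x, y) s).
  have y'y : (x, - y) != (x, y).
    rewrite xpair_eqE eqxx /= -subr_eq0 -opprD oppr_eq0 -mulr2n -mulr_natl.
    by rewrite mulf_neq0.
  have z's' : (x, - y) \in rem (x, y) s by rewrite mem_rem_uniq // inE y'y.
  have sz_s : size s = (size s').+2.
    have : (0 < size (rem (x, y) s))%N by case: (rem _ _) z's'.
    by rewrite (size_rem z's') (size_rem zs); case: (size s) => [|[|]].
  rewrite szN sz_s ltnS ltnS; apply: IHn => //.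
  - by rewrite -ltnS ltnW // -sz_s.
  - by rewrite !rem_uniq.
  move=> [u v]; rewrite /s' mem_rem_uniq ?rem_uniq // inE mem_rem_uniq // inE.
  case/and3P=> uv1 uv2 uvs; have [/= gu ABu] := sP _ uvs; split=> //=.
  (* Only (x, y) and (x, -y) lie above [x], and both were removed, so [u - x] can be cancelled in
     the induction hypothesis's equations. *)
  have ux : u - x != 0.
    rewrite subr_eq0; apply: contraNneq uv1 => eux; move: gu; rewrite eux gx.
    move/eqP; rewrite eqf_sqr => /orP[] /eqP e.
      by move: uv2; rewrite eux -e eqxx.
    by rewrite e opprK.
  apply: (mulIf ux); rewrite mul0r -[RHS]ABu defA defB !hornerM !hornerXsubC; ring.
move=> /hasPn no_pair.
have s1_uniq : uniq (map fst s).
  rewrite map_inj_in_uniq // => -[x y] [x' y'] zs z's /= exx'.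
  rewrite -{x'}exx' in z's *; congr pair.
  have [/= gx _] := sP _ zs; have [/= gx' _] := sP _ z's.
  move/eqP: gx'; rewrite gx eqf_sqr => /orP[/eqP //| /eqP e].
  have := no_pair _ zs; rewrite e /= opprK z's /= oppr_eq0 negbK => /eqP->.
  by rewrite oppr0.
rewrite -(size_map fst); apply: max_poly_roots => //.
apply/allP=> _ /mapP[[x y] zs ->] /=; have [/= gx ABx] := sP _ zs.
rewrite /root hornerD hornerN horner_exp hornerM horner_exp gx.
have -> : A.[x] = - (y * B.[x]) by apply/eqP; rewrite -addr_eq0 ABx.
by apply/eqP; ring.
Qed.

(** * Messages as blocks of four coefficients, and pole orders *)

(** The coefficient P_j(x) of y^j. A message has 4t + 1 coefficients: blocks 0 to t - 1 hold four
    each, and block t a single constant. *)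
Definition block (F : fieldType) (p : {poly F}) (j : nat) : {poly F} :=
  take_poly 4 (drop_poly (4 * j) p).

(* With [y ^+ 2 = g.[x]], the bivariate polynomial [\sum_j block p j * y ^+ j]
   becomes [curve_part t g 0 p + y * curve_part t g 1 p]. *)
Definition curve_part (F : fieldType) (t : nat) (g : {poly F}) (e : nat)
    (p : {poly F}) : {poly F} :=
  \sum_(m < t.+1) block p (2 * m + e) * g ^+ m.

Lemma coef_block (F : fieldType) (p : {poly F}) (j i : nat) :
  (block p j)`_i = if (i < 4)%N then p`_(4 * j + i) else 0.
Proof. by rewrite coef_take_poly coef_drop_poly addnC. Qed.

Lemma block_eq0 (F : fieldType) (p : {poly F}) (t j : nat) :
  (size p <= 4 * t + 1)%N -> (t < j)%N -> block p j = 0.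
Proof.
move=> szp ltj; apply/polyP=> i; rewrite coef_block coef0.
by case: ifP => // _; rewrite nth_default //; apply: leq_trans szp _; lia.
Qed.

Lemma size_last_block (F : fieldType) (p : {poly F}) (t : nat) :
  (size p <= 4 * t + 1)%N -> (size (block p t) <= 1)%N.
Proof.
move=> szp; apply/leq_sizeP=> i i_gt0; rewrite coef_block.
by case: ifP => // _; rewrite nth_default //; apply: leq_trans szp _; lia.
Qed.

Lemma block_inj0 (F : fieldType) (p : {poly F}) :
  (forall j, block p j = 0) -> p = 0.
Proof.
move=> p0; apply/polyP=> k; rewrite coef0 (divn_eq k 4) mulnC.
have := coef_block p (k %/ 4) (k %% 4).
by rewrite p0 coef0 ltn_pmod // => <-.
Qed.

(** Uniqueness of base-[g] digits: [g] divides the lowest digit, which is too small to be nonzero;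
    then divide the sum by [g] and repeat. *)
Lemma base_expansion_eq0 (F : fieldType) (g : {poly F}) (n : nat)
    (P : nat -> {poly F}) :
  (forall m, (size (P m) < size g)%N) ->
  \sum_(m < n) P m * g ^+ m = 0 -> forall m, (m < n)%N -> P m = 0.
Proof.
elim: n P => // n IHn P szP; rewrite big_ord_recl expr0 mulr1 /=.
have -> : \sum_(i < n) P (bump 0 i) * g ^+ bump 0 i
    = g * \sum_(i < n) P i.+1 * g ^+ i.
  by rewrite mulr_sumr; apply: eq_bigr => i _; rewrite /bump /= add1n exprS mulrCA.
move=> sum0; have g_neq0 : g != 0.
  by rewrite -size_poly_gt0; apply: leq_trans (szP 0); rewrite ltnS.
have P0 : P 0 = 0.
  apply: contraTeq (szP 0) => /dvdp_leq le_g; rewrite -leqNgt; apply: le_g.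
  move/eqP: sum0; rewrite addr_eq0 => /eqP ->.
  by rewrite dvdpNr dvdp_mulIl.
move: sum0; rewrite P0 add0r => /eqP; rewrite mulf_eq0 (negPf g_neq0) /=.
move=> /eqP sum0 [//|m]; rewrite ltnS; exact: (IHn (fun m => P m.+1)).
Qed.

(** Both parts are base-[g] expansions, since blocks have size at most 4; one yields the blocks of
    even index, the other those of odd index. *)
Lemma curve_parts_eq0 (F : fieldType) (t : nat) (g p : {poly F}) :
  size g = 6%N -> (size p <= 4 * t + 1)%N ->
  curve_part t g 0 p = 0 -> curve_part t g 1 p = 0 -> p = 0.
Proof.
move=> szg szp A0 B0; apply: block_inj0 => j.
have sz_lt e m : (size (block p (2 * m + e)) < size g)%N.
  by rewrite szg; apply: leq_ltn_trans (size_take_poly _ _) _.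
have [ltj | lejt] := ltnP t j; first exact: block_eq0 ltj.
have -> : j = (2 * j./2 + odd j)%N by lia.
have lt_t : (j./2 < t.+1)%N by lia.
by case: (odd j); apply: (base_expansion_eq0 (sz_lt _) _ lt_t).
Qed.

Lemma size_curve_term (F : fieldType) (g Q : {poly F}) (s m : nat) :
  size g = 6%N -> (size Q <= s)%N -> (0 < s)%N -> (size (Q * g ^+ m)%R <= s + 5 * m)%N.
Proof.
move=> szg szQ s_gt0; apply: leq_trans (size_polyMleq _ _) _.
have := size_poly_exp_leq g m; rewrite szg /=; move: szQ.
by move: (size Q) (size (g ^+ m)%R) => u v; lia.
Qed.

(** At infinity x has pole order 2 and y pole order 5. A block j < t contributes at most 6 + 5j <=
    5t + 1, and the constant block t at most 5t; twice the degree is thus at most 5t + 1. *)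
Lemma size_curve_part0 (F : fieldType) (t : nat) (g p : {poly F}) :
  size g = 6%N -> (size p <= 4 * t + 1)%N ->
  (2 * size (curve_part t g 0 p) <= 5 * t + 3)%N.
Proof.
move=> szg szp; suff : (size (curve_part t g 0 p) <= (5 * t + 3) %/ 2)%N by lia.
apply: leq_trans (size_sum _ _ _) _; apply/bigmax_leqP=> m _; rewrite addn0.
have [ltm | lemt] := ltnP t (2 * m).
  by rewrite (block_eq0 szp) // mul0r size_poly0.
have [eqm | nem] := eqVneq t (2 * m)%N.
  have := size_last_block szp; rewrite {1}eqm => /(size_curve_term m szg).
  by move/(_ isT); lia.
have := size_curve_term m szg (size_take_poly 4 (drop_poly (4 * (2 * m)) p)).
by move/(_ isT); rewrite -/(block _ _); lia.
Qed.

(** The factor y in front uses 5 of the pole order: 5 + 2 deg <= 5t + 1. For t = 0 the truncated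
    bound is 0, and the part does vanish. *)
Lemma size_curve_part1 (F : fieldType) (t : nat) (g p : {poly F}) :
  size g = 6%N -> (size p <= 4 * t + 1)%N ->
  (2 * size (curve_part t g 1 p) <= 5 * t - 2)%N.
Proof.
move=> szg szp; suff : (size (curve_part t g 1 p) <= (5 * t - 2) %/ 2)%N by lia.
apply: leq_trans (size_sum _ _ _) _; apply/bigmax_leqP=> m _.
have [ltm | lemt] := ltnP t (2 * m + 1).
  by rewrite (block_eq0 szp) // mul0r size_poly0.
have [eqm | nem] := eqVneq t (2 * m + 1)%N.
  have := size_last_block szp; rewrite {1}eqm => /(size_curve_term m szg).
  by move/(_ isT); lia.
have := size_curve_term m szg (size_take_poly 4 (drop_poly (4 * (2 * m + 1)) p)).
by move/(_ isT); rewrite -/(block _ _); lia.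
Qed.

Lemma curve_norm_neq0 (F : fieldType) (g A B : {poly F}) :
  size g = 6%N -> A ^+ 2 - g * B ^+ 2 = 0 -> A = 0 /\ B = 0.
Proof.
move=> szg /eqP; rewrite subr_eq0 => /eqP eqAB.
have g_neq0 : g != 0 by rewrite -size_poly_gt0 szg.
have [B0 | B_neq0] := eqVneq B 0.
  split=> //; apply/eqP; rewrite -sqrf_eq0 eqAB B0; apply/eqP; ring.
have A_neq0 : A != 0 by rewrite -sqrf_eq0 eqAB mulf_neq0 ?expf_neq0.
(* The two sides have degrees of different parities. *)
have := congr1 (size \o polyseq) eqAB.
rewrite /= !expr2 !size_mul ?mulf_neq0 // szg.
have := size_poly_gt0 A; have := size_poly_gt0 B.
rewrite A_neq0 B_neq0.
by move: (size A) (size B) => u v; lia.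
Qed.

Lemma size_curve_norm (F : fieldType) (t : nat) (g p : {poly F}) :
  size g = 6%N -> (size p <= 4 * t + 1)%N ->
  (size (curve_part t g 0 p ^+ 2 - g * curve_part t g 1 p ^+ 2)%R <= 5 * t + 2)%N.
Proof.
move=> szg szp; apply: leq_trans (size_polyD _ _) _; rewrite size_polyN geq_max.
have szA := size_curve_part0 szg szp; have szB := size_curve_part1 szg szp.
apply/andP; split.
  by apply: leq_trans (size_poly_exp_leq _ _) _; lia.
have [-> | B_neq0] := eqVneq (curve_part t g 1 p) 0.
  by rewrite expr0n mulr0 size_poly0.
apply: leq_trans (size_polyMleq _ _) _.
have := size_poly_exp_leq (curve_part t g 1 p) 2; rewrite szg.
move: B_neq0 szB; rewrite -size_poly_gt0.
move: (size (curve_part t g 1 p)) (size (curve_part t g 1 p ^+ 2)%R) => u v; lia.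
Qed.

(** For fixed [y] the right side evaluates one polynomial in x, a combination of blocks and so of
    degree at most 3; locality rests on this form. *)
Lemma horner_curve_parts (F : fieldType) (t : nat) (g p : {poly F}) (x y : F) :
  g.[x] = y ^+ 2 ->
  (curve_part t g 0 p).[x] + y * (curve_part t g 1 p).[x]
    = (\sum_(m < t.+1) (y ^+ (2 * m) *: block p (2 * m + 0)
                        + y ^+ (2 * m).+1 *: block p (2 * m + 1))).[x].
Proof.
move=> gx; rewrite !horner_sum mulr_sumr -big_split /=; apply: eq_bigr => m _.
by rewrite hornerM horner_exp gx hornerM horner_exp gx hornerD !hornerZ -exprM exprS; ring.
Qed.

Lemma curve_part_is_linear (F : fieldType) (t : nat) (g : {poly F}) (e : nat) :
  linear (curve_part t g e).
Proof.
move=> a p q; rewrite /curve_part scaler_sumr -big_split; apply: eq_bigr => m _ /=.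
by rewrite /block !linearP /= mulrDl scalerAl.
Qed.

Lemma min_dist_exists (F : finFieldType) (n : nat) (C : {vspace 'rV[F]_n}) :
  (0 < \dim C)%N -> exists d : nat, is_min_dist C d.
Proof.
rewrite lt0n dimv_eq0 => C0.
pose P d := [exists c, [exists c', [&& c \in C, c' \in C, c != c' & hdist c c' == d]]].
have exP : exists d, P d.
  exists (hdist (vpick C) 0); apply/existsP; exists (vpick C); apply/existsP; exists 0.
  by rewrite memv_pick mem0v vpick0 C0 eqxx.
case: (ex_minnP exP) => d /existsP[c /existsP[c' /and4P[cC c'C ne_c /eqP dist_c]]] min_d.
exists d; split; first by exists c, c'.
move=> b b' bC b'C ne_b; apply: min_d; apply/existsP; exists b; apply/existsP; exists b'.
by rewrite bC b'C ne_b eqxx.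
Qed.

(** * The evaluation code: dimension, distance and locality *)

Section EvaluationCode.

Variables (F : finFieldType) (t l : nat) (g : {poly F}) (ys : nat -> F)
          (xs : nat -> nat -> F).
Hypotheses (two0 : 2%:R != 0 :> F) (szg : size g = 6%N) (lt_tl : (t < l)%N).
Hypothesis ys_inj : forall i j, (i < l)%N -> (j < l)%N -> ys i = ys j -> i = j.
Hypothesis xs_inj : forall i j k, (i < l)%N -> (j < 5)%N -> (k < 5)%N ->
  xs i j = xs i k -> j = k.
Hypothesis on_curve : forall i j, (i < l)%N -> (j < 5)%N ->
  g.[xs i j] = ys i ^+ 2.

Definition point (c : nat) : F * F := (xs (c %/ 5) (c %% 5), ys (c %/ 5)).

Definition evalp (A B : {poly F}) (z : F * F) : F := A.[z.1] + z.2 * B.[z.1].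

Definition encode (u : 'rV[F]_(4 * t + 1)) : 'rV[F]_(5 * l) :=
  \row_c evalp (curve_part t g 0 (rVpoly u)) (curve_part t g 1 (rVpoly u)) (point c).

Lemma encode_is_linear : linear encode.
Proof.
move=> a u v; apply/rowP=> c; rewrite !mxE linearP !curve_part_is_linear /evalp.
by rewrite !hornerD !hornerZ; ring.
Qed.

HB.instance Definition _ :=
  GRing.isLinear.Build F 'rV[F]_(4 * t + 1) 'rV[F]_(5 * l) _ encode encode_is_linear.

Lemma fibre_lt (c : 'I_(5 * l)) : (c %/ 5 < l)%N.
Proof. by have := ltn_ord c; lia. Qed.

Lemma point_inj (c c' : 'I_(5 * l)) : point c = point c' -> c = c'.
Proof.
case=> + eqy; have eqd := ys_inj (fibre_lt c) (fibre_lt c') eqy.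
rewrite -eqd => /(xs_inj (fibre_lt c)) eqm; apply/val_inj.
by rewrite /= (divn_eq c 5) (divn_eq c' 5) eqd eqm ?ltn_pmod.
Qed.

Lemma point_on_curve (c : 'I_(5 * l)) : g.[(point c).1] = (point c).2 ^+ 2.
Proof. by rewrite on_curve ?ltn_pmod ?fibre_lt. Qed.

Lemma size_message (u : 'rV[F]_(4 * t + 1)) : (size (rVpoly u) <= 4 * t + 1)%N.
Proof. exact: size_poly. Qed.

Lemma card_zeros_encode (u : 'rV[F]_(4 * t + 1)) :
  u != 0 -> (#|[set c | encode u ord0 c == 0%R]| <= 5 * t + 1)%N.
Proof.
move=> u0; set Z := [set c | _].
rewrite cardE -(size_map (point \o val)) -ltnS.
set A := curve_part t g 0 (rVpoly u); set B := curve_part t g 1 (rVpoly u).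
apply: leq_trans (_ : _ <= size (A ^+ 2 - g * B ^+ 2)%R)%N _; last first.
  by have := size_curve_norm szg (size_message u); rewrite -addnS.
apply: size_curve_zeros => //.
- apply: contra_neq u0 => /(curve_norm_neq0 szg)[A0 B0].
  by rewrite -[u]rVpolyK (curve_parts_eq0 szg (size_message u) A0 B0) linear0.
- rewrite map_inj_uniq ?enum_uniq // => c c' /=; exact: point_inj.
move=> _ /mapP[c cZ ->]; split; first exact: point_on_curve.
by move: cZ; rewrite mem_enum inE mxE => /eqP.
Qed.

Definition eval_code : {vspace 'rV[F]_(5 * l)} := limg (linfun encode).

Lemma eval_codeP (c : 'rV[F]_(5 * l)) :
  reflect (exists u, c = encode u) (c \in eval_code).
Proof.
apply: (iffP memv_imgP) => [[u _ ->] | [u ->]]; exists u; rewrite ?lfunE ?memvf //.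
Qed.

(** A nonzero message has at most 5t + 1 zeros, fewer than the 5l coordinates because t < l. *)
Lemma encode_inj : injective encode.
Proof.
move=> u v /eqP; rewrite -subr_eq0 -raddfB => /eqP e0; apply/eqP.
rewrite -subr_eq0; apply: contraT => /card_zeros_encode.
rewrite e0; under eq_finset do rewrite mxE eqxx.
by rewrite cardsT card_ord; lia.
Qed.

Lemma dim_eval_code : \dim eval_code = (4 * t + 1)%N.
Proof.
rewrite limg_dim_eq ?dimvf /dim /= ?mul1n //.
apply/eqP; rewrite -subv0 (subv_trans (capvSr _ _)) // subv0.
by apply/lker0P => u v; rewrite !lfunE; apply: encode_inj.
Qed.

Lemma hdist_eval_code (c c' : 'rV[F]_(5 * l)) :
  c \in eval_code -> c' \in eval_code -> c != c' ->
  (5 * l - 5 * t - 1 <= hdist c c')%N.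
Proof.
case/eval_codeP=> u ->{c} /eval_codeP[v ->{c'}] ne_uv.
have uv0 : u - v != 0 by rewrite subr_eq0; apply: contra_neq ne_uv => ->.
have := card_zeros_encode uv0; set Z := [set c | _].
have -> : hdist (encode u) (encode v) = #|~: Z|.
  by apply: eq_card => c; rewrite !inE raddfB !mxE subr_eq0.
by have := cardsC Z; rewrite card_ord; move: #|Z| #|~: Z| => x y; lia.
Qed.

Lemma locality_eval_code : has_locality eval_code 4.
Proof.
move=> i; have lti := fibre_lt i.
have lt5 (k : 'I_5) : (5 * (i %/ 5) + k < 5 * l)%N by have := ltn_ord k; lia.
(* [f] lists the five coordinates in the fibre of [i], with [i] at position [k0]; the other four
   form the recovery set. *)
pose f k := Ordinal (lt5 k).
pose k0 : 'I_5 := Ordinal (ltn_pmod i (isT : 0 < 5)%N).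
have f_inj : injective f by move=> k k' /(congr1 val) /= /addnI /val_inj.
have pointf k : point (f k) = (xs (i %/ 5) k, ys (i %/ 5)).
  rewrite /point /=; congr (xs _ _, ys _); have := ltn_ord k; lia.
have fk0 : f k0 = i by apply/val_inj; rewrite /= mulnC -divn_eq.
exists (f @: [set~ k0]); split.
- by rewrite -[X in X \notin _]fk0 mem_imset // !inE eqxx.
- by rewrite card_imset // cardsC1 card_ord.
move=> _ _ /eval_codeP[u ->] /eval_codeP[v ->] ne_i.
case: (boolP [exists k, (k != k0) && (encode u ord0 (f k) != encode v ord0 (f k))]).
  case/existsP=> k /andP[kk0 ne_k]; exists (f k) => //.
  by rewrite mem_imset // !inE.
rewrite negb_exists => /forallP eq_k; case/eqP: ne_i.
apply/eqP; rewrite -subr_eq0 -[_ - _](_ : encode (u - v) ord0 i = _); last first.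
  by rewrite raddfB !mxE.
set p := rVpoly (u - v).
pose R := \sum_(m < t.+1) (ys (i %/ 5) ^+ (2 * m) *: block p (2 * m + 0)
                        + ys (i %/ 5) ^+ (2 * m).+1 *: block p (2 * m + 1)).
have encR k : encode (u - v) ord0 (f k) = R.[xs (i %/ 5) k].
  by rewrite mxE /evalp pointf /= horner_curve_parts // on_curve.
suff R0 : R = 0 by rewrite -fk0 encR R0 horner0.
have szR : (size R <= 4)%N.
  apply: leq_trans (size_sum _ _ _) _; apply/bigmax_leqP=> m _.
  apply: leq_trans (size_polyD _ _) _; rewrite geq_max.
  by rewrite !(leq_trans (size_scale_leq _ _)) ?size_take_poly.
apply: contraTeq szR => R_neq0; rewrite -ltnNge.
(* If [u] and [v] agree on the recovery set, [R] has these four distinct roots, too many for degree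
   3. *)
set s := [seq xs (i %/ 5) (val k) | k <- enum [set~ k0]].
have sz_s : size s = 4%N by rewrite size_map -cardE cardsC1 card_ord.
suff : (size s < size R)%N by rewrite sz_s.
apply: max_poly_roots => //.
  apply/allP=> _ /mapP[k kk0 ->]; rewrite /root -encR raddfB !mxE subr_eq0.
  by have := eq_k k; move: kk0; rewrite mem_enum !inE => ->; rewrite !mxE negbK.
rewrite map_inj_in_uniq ?enum_uniq // => k k' _ _ /(xs_inj lti) e.
by apply/val_inj/e; apply: ltn_ord.
Qed.

End EvaluationCode.

Lemma lrc_of_fibres (F : finFieldType) (g : {poly F}) (Y : {set F}) (t l : nat) :
  2%:R != 0 :> F -> size g = 6%N ->
  {in Y, forall y, 5 <= #|[set x | g.[x] == y ^+ 2]|}%N ->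
  (t < l)%N -> (l <= #|Y|)%N ->
  exists (C : {vspace 'rV[F]_(5 * l)}) (d : nat),
    [/\ \dim C = (4 * t + 1)%N,
        has_locality C 4,
        is_min_dist C d,
        (5 * l - 5 * t - 1 <= d)%N &
        (defect (5 * l) (4 * t + 1) 4 d <= 1)%R].
Proof.
move=> two0 szg fibreY lt_tl le_lY.
pose ys i := nth 0 (enum Y) i.
pose xs i j := nth 0 (enum [set x | g.[x] == ys i ^+ 2]) j.
have lt_Y i : (i < l)%N -> (i < size (enum Y))%N.
  by rewrite -cardE => /leq_trans; apply.
have ysY i : (i < l)%N -> ys i \in Y by move=> /lt_Y lti; rewrite -mem_enum mem_nth.
have lt_fibre i j : (i < l)%N -> (j < 5)%N ->
    (j < size (enum [set x | g.[x] == ys i ^+ 2]))%N.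
  by rewrite -cardE => /ysY/fibreY le5 ltj; apply: leq_trans le5.
have ys_inj i j : (i < l)%N -> (j < l)%N -> ys i = ys j -> i = j.
  by move=> /lt_Y lti /lt_Y ltj /eqP; rewrite nth_uniq ?enum_uniq // => /eqP.
have xs_inj i j k : (i < l)%N -> (j < 5)%N -> (k < 5)%N -> xs i j = xs i k -> j = k.
  move=> lti ltj ltk /eqP; rewrite nth_uniq ?enum_uniq ?lt_fibre //.
  by move/eqP.
have on_curve i j : (i < l)%N -> (j < 5)%N -> g.[xs i j] = ys i ^+ 2.
  move=> lti ltj; apply/eqP; have := mem_nth 0 (lt_fibre i j lti ltj).
  by rewrite mem_enum inE.
pose C := eval_code t l g ys xs.
have dimC : \dim C = (4 * t + 1)%N by apply: dim_eval_code.
have [|d [[c [c' [cC c'C ne_c dist_c]]] min_d]] := @min_dist_exists _ _ C.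
  by rewrite dimC addn1.
have le_d : (5 * l - 5 * t - 1 <= d)%N.
  by rewrite -dist_c; apply: (hdist_eval_code two0 szg) cC c'C ne_c.
exists C, d; split=> //; first exact: locality_eval_code.
  by split=> //; exists c, c'.
(* As ceil((4t + 1) / 4) = t + 1, the defect is 5l - 5t - d. *)
by rewrite /defect /ceil_div; lia.
Qed.

(** * Full fibres of maximal genus-2 curves *)

Lemma finField_prim_root (F : finFieldType) :
  exists z : F, (#|F|.-1).-primitive_root z.
Proof.
have F_gt1 : (1 < #|F|)%N by apply: finNzRing_gt1.
pose rs := enum [set~ (0 : F)].
have sz_rs : size rs = #|F|.-1 by rewrite -cardE cardsC1.
have /hasP[z _ prim_z] : has (#|F|.-1).-primitive_root rs; last by exists z.
apply: has_prim_root; rewrite ?enum_uniq ?sz_rs //; first by lia.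
apply/allP=> x; rewrite mem_enum !inE => x0; apply/unity_rootP.
by apply: (mulfI x0); rewrite mulr1 -exprS prednK ?expf_card // ltnW.
Qed.

Lemma card_unity_roots (F : finFieldType) (d : nat) :
  (d %| #|F|.-1)%N -> #|[set x : F | x ^+ d == 1]| = d.
Proof.
have [z prim_z] := finField_prim_root F => /(dvdn_prim_root prim_z) prim_w.
set w := z ^+ _ in prim_w; have d_gt0 := prim_order_gt0 prim_w.
have -> : [set x : F | x ^+ d == 1] = [set w ^+ i | i : 'I_d].
  apply/setP=> x; rewrite inE; apply/eqP/imsetP=> [xd1 | [i _ ->]].
    by have [i ->] := prim_rootP prim_w xd1; exists i.
  by rewrite exprAC (prim_expr_order prim_w) expr1n.
rewrite card_imset ?card_ord // => i j /eqP.
by rewrite (eq_prim_root_expr prim_w) !modn_small // => /eqP/val_inj.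
Qed.

(** Write x = z^i with z a generator of the unit group, of order n. Then x^(n/d) = 1 says that n
    divides i n/d, that is, d divides i. *)
Lemma exp_root_exists (F : finFieldType) (d : nat) (x : F) :
  (d %| #|F|.-1)%N -> x ^+ (#|F|.-1 %/ d) = 1 -> exists y, x = y ^+ d.
Proof.
have [z prim_z] := finField_prim_root F; have n_gt0 := prim_order_gt0 prim_z.
move=> dvd_d x1; have [|i def_x] := prim_rootP prim_z (x := x).
  by rewrite -(divnK dvd_d) exprM x1 expr1n.
have : (#|F|.-1 %| i * (#|F|.-1 %/ d))%N.
  by rewrite (prim_order_dvd prim_z) exprM -def_x x1.
have [e_gt0 d_gt0] : (0 < #|F|.-1 %/ d)%N /\ (0 < d)%N.
  by move: n_gt0; rewrite -{1}(divnK dvd_d) muln_gt0 => /andP.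
rewrite -{1}(divnK dvd_d) mulnC dvdn_pmul2r // => dvd_i.
by exists (z ^+ (i %/ d)); rewrite -exprM divnK.
Qed.

Lemma unity_root_neq0 (F : fieldType) (d : nat) (x : F) :
  (0 < d)%N -> x ^+ d = 1 -> x != 0.
Proof.
move=> d_gt0 xd1; apply: contra_eq_neq xd1 => ->.
by rewrite expr0n eqn0Ngt d_gt0 eq_sym oner_neq0.
Qed.

(** Arithmetic for [card_square_cofifth]: [P] counts pairs of roots of unity, and Q - 2 the elements
    of F_Q other than 0 and 1. *)
Lemma pair_count_bound (m P Q : nat) :
  (0 < m -> Q + 1 = 10 * m ->
   (5 * m - 1) * (2 * m - 1) <= P + (m - 1) ->
   10 * m ^ 2 + 2 * m - 1 <= P + (Q - 2))%N.
Proof.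
case: m => // k _ eqQ; rewrite (_ : 5 * k.+1 - 1 = 5 * k + 4)%N; last lia.
rewrite (_ : 2 * k.+1 - 1 = 2 * k + 1)%N; last lia.
rewrite (_ : Q - 2 = 10 * k + 7)%N; last lia.
nia.
Qed.

(** * The Frobenius map x^Q on the field of Q^2 elements *)

Section FrobeniusSquareRoot.

Variables (F : finFieldType) (Q : nat).
Hypotheses (pcharQ : [pchar F].-nat Q) (Q_gt1 : (1 < Q)%N) (cardF : #|F| = (Q ^ 2)%N).

Lemma card_units_factor : #|F|.-1 = ((Q - 1) * (Q + 1))%N.
Proof. by rewrite cardF -subn1 (_ : Q ^ 2 - 1 = Q ^ 2 - 1 ^ 2)%N ?subn_sqr. Qed.

Lemma frobB (x y : F) : (x - y) ^+ Q = x ^+ Q - y ^+ Q.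
Proof. by rewrite exprDn_pchar // exprNn_pchar. Qed.

Lemma exp_unit_frob (x : F) (a : F) : x != 0 -> x ^+ Q = a * x -> x ^+ (Q - 1) = a.
Proof.
by move=> x0 eqx; apply: (mulIf x0); rewrite -exprSr -eqx; congr (_ ^+ _); lia.
Qed.

(** * The curve y^2 = x^5 + 1 when 10 divides Q + 1 *)

Section FifthPowers.

Variable m : nat.
Hypotheses (Q10 : (Q + 1 = 10 * m)%N).

Let frob_unity_root (d : nat) (a : F) :
  (d %| Q + 1)%N -> a ^+ d = 1 -> a ^+ Q = a^-1.
Proof.
move=> /dvdnP[e eqe] ad1; have a0 : a != 0.
  by apply: unity_root_neq0 ad1; case: d eqe => [|d] eqe; lia.
by apply: (mulIf a0); rewrite -exprSr -addn1 eqe mulnC exprM ad1 expr1n mulVf.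
Qed.

(* For distinct (Q+1)-th roots of unity a, b other than 1, the equations
   x^(Q-1) = a and (1-x)^(Q-1) = b have the single solution (1-b)/(a-b). *)
Definition coset_point (z : F * F) : F := (1 - z.2) / (z.1 - z.2).

(** For a = x^(Q-1) and b = (1-x)^(Q-1), the exponents 5m = (Q+1)/2 and 2m = (Q+1)/5 say that x is a
    square and 1 - x a fifth power. *)
Let pairs := [set z : F * F |
  [&& z.1 ^+ (5 * m) == 1, z.1 != 1, z.2 ^+ (2 * m) == 1, z.2 != 1 & z.1 != z.2]].

Let dvd5m : (5 * m %| Q + 1)%N. Proof. by rewrite Q10 dvdn_mul. Qed.
Let dvd2m : (2 * m %| Q + 1)%N. Proof. by rewrite Q10 dvdn_mul. Qed.

(** The map x^Q inverts the (Q+1)-th roots of unity a and b; replacing them by their inverses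
    multiplies (1-b)/(a-b) by a, and (a-1)/(a-b) by b. *)
Lemma coset_pointP (z : F * F) : z \in pairs ->
  [/\ coset_point z != 0, 1 - coset_point z != 0,
      coset_point z ^+ (Q - 1) = z.1 & (1 - coset_point z) ^+ (Q - 1) = z.2].
Proof.
case: z => a b; rewrite inE /= => /and5P[/eqP a1 an1 /eqP b1 bn1 nab].
have ab0 : a - b != 0 by rewrite subr_eq0.
have b10 : 1 - b != 0 by rewrite subr_eq0 eq_sym.
have a10 : a - 1 != 0 by rewrite subr_eq0.
have a0 : a != 0 by apply: unity_root_neq0 a1; lia.
have b0 : b != 0 by apply: unity_root_neq0 b1; lia.
have aQ := frob_unity_root dvd5m a1; have bQ := frob_unity_root dvd2m b1.
have def1x : 1 - coset_point (a, b) = (a - 1) / (a - b).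
  by rewrite /coset_point /=; field.
have xQ : coset_point (a, b) ^+ Q = a * coset_point (a, b).
  rewrite expr_div_n !frobB expr1n aQ bQ /coset_point /=; field.
  by rewrite ab0 a0 b0 mulN1r subr_eq0 eq_sym.
have x0 : coset_point (a, b) != 0 by rewrite mulf_neq0 ?invr_eq0.
have x10 : 1 - coset_point (a, b) != 0 by rewrite def1x mulf_neq0 ?invr_eq0.
split=> //; first exact: exp_unit_frob.
apply: exp_unit_frob => //; rewrite frobB expr1n xQ /coset_point /=.
by field.
Qed.

(** Since 5m(Q-1) = (q-1)/2 and 2m(Q-1) = (q-1)/5, these are the nonzero squares x with 1 - x a
    nonzero fifth power. *)
Definition square_cofifth : {set F} :=
  [set x | (x ^+ (5 * m * (Q - 1)) == 1) && ((1 - x) ^+ (2 * m * (Q - 1)) == 1)].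

(** From all pairs of nontrivial roots only the diagonal is dropped; a^(5m) = a^(2m) = 1 forces a^m
    = 1, which leaves at most m - 1 diagonal pairs. *)
Lemma card_pairs : ((5 * m - 1) * (2 * m - 1) <= #|pairs| + (m - 1))%N.
Proof.
have card_nontrivial d : (d %| Q + 1)%N ->
    #|[set x : F | x ^+ d == 1] :\ 1| = (d - 1)%N.
  move=> dvd_d; have dvdF : (d %| #|F|.-1)%N by rewrite card_units_factor dvdn_mull.
  have := cardsD1 1 [set x : F | x ^+ d == 1].
  by rewrite card_unity_roots // inE expr1n eqxx => e; rewrite [in RHS]e addKn.
have dvd_m : (m %| Q + 1)%N by rewrite Q10 dvdn_mull.
rewrite -(card_nontrivial _ dvd5m) -(card_nontrivial _ dvd2m) -(card_nontrivial _ dvd_m).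
rewrite -cardsX -(card_imset _ (_ : injective (fun a : F => (a, a)))); last by move=> a b [].
apply: leq_trans (leq_card_setU _ _); apply/subset_leq_card/subsetP=> -[a b].
rewrite !inE /= => /andP[/andP[a1 a5] /andP[b1 b2]]; rewrite a1 a5 b1 b2 /=.
have [eq_ab /=| //] := eqVneq a b; rewrite -eq_ab in b2 *.
apply/imsetP; exists a => //; rewrite !inE a1 /=.
have := eqxx (1 : F); rewrite -{1}(eqP a5) (_ : 5 * m = 2 * m * 2 + m)%N; last by lia.
by rewrite exprD exprM (eqP b2) expr1n mul1r.
Qed.

(** Two disjoint supplies: the injective image of [pairs], and the elements of F_Q other than 0 and
    1, which realise a = b = 1. *)
Lemma card_square_cofifth : (10 * m ^ 2 + 2 * m - 1 <= #|square_cofifth|)%N.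
Proof.
have m_gt0 : (0 < m)%N by lia.
pose L := [set x : F | x ^+ (Q - 1) == 1] :\ 1.
have cardL : #|L| = (Q - 2)%N.
  have dvdF : (Q - 1 %| #|F|.-1)%N by rewrite card_units_factor dvdn_mulr.
  have := cardsD1 1 [set x : F | x ^+ (Q - 1) == 1].
  rewrite card_unity_roots // inE expr1n eqxx -/L => e.
  have -> : (Q - 2 = Q - 1 - 1)%N by lia.
  by rewrite [in RHS]e addKn.
have cardP : #|coset_point @: pairs| = #|pairs|.
  apply/card_in_imset/(can_in_inj (g := fun x => (x ^+ (Q - 1), (1 - x) ^+ (Q - 1)))).
  by move=> [a b] /coset_pointP[_ _ -> ->].
have disj : [disjoint coset_point @: pairs & L].
  rewrite -setI_eq0; apply/eqP/setP=> x; rewrite !inE.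
  apply/negP=> /and3P[/imsetP[z zP ->] _]; have [_ _ -> _] := coset_pointP zP.
  by move: zP; rewrite inE => /and5P[_ /negPf->].
apply: leq_trans (_ : #|coset_point @: pairs :|: L| <= _)%N.
  rewrite cardsU (disjoint_setI0 disj) cards0 subn0 cardP cardL.
  exact: pair_count_bound m_gt0 Q10 card_pairs.
have expQ1 (y : F) d : y ^+ (d * (Q - 1)) = (y ^+ (Q - 1)) ^+ d by rewrite mulnC exprM.
apply/subset_leq_card/subsetP=> x; rewrite !inE !expQ1 => /orP[/imsetP[z zP ->] | /andP[x1 /eqP xQ]].
  have [_ _ zQ1 zQ2] := coset_pointP zP.
  rewrite zQ1 zQ2.
  by move: zP; rewrite inE => /and5P[-> _ ->].
have x0 : x != 0.
  by apply: unity_root_neq0 xQ; rewrite subn_gt0.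
have eqxQ : x ^+ Q = x by rewrite -{1}(subnK (ltnW Q_gt1)) addn1 exprSr xQ mul1r.
have x10 : 1 - x != 0 by rewrite subr_eq0 eq_sym.
rewrite xQ expr1n (exp_unit_frob (a := 1)) ?expr1n ?eqxx //.
by rewrite frobB expr1n eqxQ mul1r.
Qed.

(** The ordinates taken are the square roots of elements of [square_cofifth], two for each, which
    doubles the count. *)
Lemma fibres_X5_add1 : 2%:R != 0 :> F -> exists (g : {poly F}) (Y : {set F}),
  [/\ size g = 6%N, {in Y, forall y, 5 <= #|[set x | g.[x] == y ^+ 2]|}%N
    & (20 * m ^ 2 + 4 * m - 2 <= #|Y|)%N].
Proof.
move=> two0; have m_gt0 : (0 < m)%N by lia.
have dvdF d : (d %| 10 * m)%N -> (d %| #|F|.-1)%N.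
  by rewrite -Q10 card_units_factor; apply: dvdn_mull.
have div_half : (#|F|.-1 %/ 2 = 5 * m * (Q - 1))%N.
  by rewrite card_units_factor Q10 (_ : 10 = 2 * 5)%N // -mulnA mulnCA mulKn // mulnC.
have div_fifth : (#|F|.-1 %/ 5 = 2 * m * (Q - 1))%N.
  by rewrite card_units_factor Q10 (_ : 10 = 5 * 2)%N // -mulnA mulnCA mulKn // mulnC.
have szg : size ('X^5 + 1 : {poly F}) = 6%N by rewrite size_polyDl size_polyXn ?size_poly1.
exists ('X^5 + 1), [set y | y ^+ 2 \in square_cofifth]; split=> // [y|].
  rewrite !inE => /andP[_ /eqP y5].
  have [w def_w] : exists w, 1 - y ^+ 2 = w ^+ 5.
    by apply: exp_root_exists; rewrite ?div_fifth //; apply: dvdF; apply: dvdn_mulr.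
  have w0 : w != 0.
    have : w ^+ 5 != 0; last by rewrite expf_eq0.
    by rewrite -def_w; apply: unity_root_neq0 y5; rewrite !muln_gt0 m_gt0 subn_gt0.
  have dvd5 : (5 %| #|F|.-1)%N by apply: dvdF; apply: dvdn_mulr.
  (* With 1 - y^2 = w^5, the points -aw for the five fifth roots of unity a lie in the fibre of
     y. *)
  rewrite -[X in (X <= _)%N](card_unity_roots dvd5).
  rewrite -(card_imset _ (_ : injective (fun a => - (a * w)))); last first.
    by move=> a b /oppr_inj /(mulIf w0).
  apply/subset_leq_card/subsetP=> _ /imsetP[a + ->]; rewrite !inE => /eqP a5.
  rewrite hornerD hornerXn hornerC exprNn exprMn a5 mul1r -def_w.
  by apply/eqP; ring.
have sqrt_ex x : x \in square_cofifth -> exists y : F, x == y ^+ 2.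
  rewrite inE => /andP[/eqP x2 _]; have dvd2 : (2 %| #|F|.-1)%N.
    by apply: dvdF; apply: dvdn_mulr.
  by have [|y ->] := exp_root_exists dvd2 (x := x); [rewrite div_half | exists y].
(* A chosen square root; the default 0 is never taken on [square_cofifth]. *)
pose r (x : F) : F := odflt 0 [pick y : F | x == y ^+ 2].
have rP x : x \in square_cofifth -> r x ^+ 2 = x.
  move=> /sqrt_ex[y0 y0P]; rewrite /r; case: pickP => [y /eqP //|/(_ y0)].
  by rewrite y0P.
have r_neq0 x : x \in square_cofifth -> r x != 0.
  move=> xS; rewrite -sqrf_eq0 rP //; move: xS; rewrite inE => /andP[/eqP x1 _].
  by apply: unity_root_neq0 x1; rewrite !muln_gt0 m_gt0 subn_gt0.
have f_inj : {in setX square_cofifth [set: bool] &,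
    injective (fun z : F * bool => (-1) ^+ z.2 * r z.1)}.
  move=> [x b] [x' b']; rewrite !in_setX !in_setT !andbT /= => xS x'S e.
  have exx' : x = x'.
    by have /= := congr1 (fun y => y ^+ 2) e; rewrite !exprMn !sqrr_sign !mul1r !rP.
  rewrite -{x' x'S}exx' in e *; congr pair; move/(mulIf (r_neq0 _ xS)): e.
  have m1_neq1 : -1 != 1 :> F by rewrite -subr_eq0 -opprD oppr_eq0.
  by case: b; case: b' => //= eb; case/eqP: m1_neq1; rewrite -[LHS]expr1 ?eb -?eb.
apply: leq_trans (_ : #|setX square_cofifth [set: bool]| <= _)%N.
  by rewrite cardsX cardsT card_bool; have := card_square_cofifth; lia.
rewrite -(card_in_imset f_inj); apply/subset_leq_card/subsetP=> _ /imsetP[[x b] + ->].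
by rewrite in_setX in_setT andbT => xS; rewrite inE exprMn sqrr_sign mul1r rP.
Qed.

End FifthPowers.

End FrobeniusSquareRoot.

Lemma card_fixed_exp (F : finFieldType) (d : nat) :
  (d %| #|F|.-1)%N -> #|[set x : F | x ^+ d.+1 == x]| = d.+1.
Proof.
move=> dvd_d; have d_gt0 : (0 < d)%N.
  by apply: dvdn_gt0 dvd_d; rewrite -subn1 subn_gt0 finNzRing_gt1.
have -> : [set x : F | x ^+ d.+1 == x] = 0 |: [set x | x ^+ d == 1].
  apply/setP=> x; rewrite !inE exprSr -subr_eq0 -[X in _ - X]mul1r -mulrBl mulf_eq0.
  by rewrite subr_eq0 orbC.
rewrite cardsU1 inE card_unity_roots // expr0n eqn0Ngt d_gt0 /=.
by rewrite eq_sym oner_neq0.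
Qed.

(** * The Artin-Schreier curve in characteristic 5 *)

Section ArtinSchreier.

Variables (F : finFieldType) (Q : nat).
Hypotheses (pcharQ : [pchar F].-nat Q) (Q_gt1 : (1 < Q)%N) (cardF : #|F| = (Q ^ 2)%N).
Hypotheses (pchar5 : 5 \in [pchar F]) (dvd4 : (4 %| Q - 1)%N).

(** [L] is the subfield F_Q, and [M] the eigenspace of x^Q for the eigenvalue -1. *)
Let L := [set x : F | x ^+ Q == x].
Let M := [set x : F | x ^+ Q == - x].
Let AS (x : F) : F := x ^+ 5 - x.

Let prednQ : (Q - 1).+1 = Q. Proof. by rewrite subn1 prednK // ltnW. Qed.

Let dvd4F : (4 %| #|F|.-1)%N.
Proof. by rewrite (card_units_factor cardF) dvdn_mulr. Qed.

Let two0 : 2%:R != 0 :> F.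
Proof. by rewrite -(dvdn_pcharf pchar5). Qed.

Let nat5 : [pchar F].-nat 5.
Proof. by rewrite pnatE. Qed.

Let frobD (x y : F) : (x + y) ^+ Q = x ^+ Q + y ^+ Q.
Proof. exact: exprDn_pchar. Qed.

Let ASB (x y : F) : AS (x - y) = AS x - AS y.
Proof. by rewrite /AS exprDn_pchar // exprNn_pchar //; ring. Qed.

Let ASD (x y : F) : AS (x + y) = AS x + AS y.
Proof. by rewrite /AS exprDn_pchar //; ring. Qed.

Let card_L : #|L| = Q.
Proof.
rewrite -[RHS]prednQ -(@card_fixed_exp F) ?prednQ //.
by rewrite (card_units_factor cardF) dvdn_mulr.
Qed.

Let LM_eq0 (x : F) : x \in L -> x \in M -> x = 0.
Proof.
rewrite !inE => /eqP -> /eqP xN; apply/eqP.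
have : 2%:R * x == 0 by rewrite mulr_natl mulr2n {1}xN addNr.
by rewrite mulf_eq0 (negPf two0).
Qed.

(** From x^5 = x follows x^(4k+1) = x for every k, and Q has this form. *)
Let AS_ker_L (x : F) : AS x = 0 -> x \in L.
Proof.
move=> /eqP; rewrite subr_eq0 inE -prednQ; have /dvdnP[k ->] := dvd4.
move=> /eqP x5; elim: k => [|k IHk]; first by rewrite mul0n expr1.
by rewrite mulSn -addnS exprD (eqP IHk) -exprSr x5.
Qed.

(** The kernel of the additive map [AS] lies in [L], which meets [M] only in 0. *)
Let AS_M_inj : {in M &, injective AS}.
Proof.
move=> x y xM yM /eqP; rewrite -subr_eq0 -ASB => /eqP ASxy; apply/eqP.
rewrite -subr_eq0 (LM_eq0 (AS_ker_L ASxy)) // inE frobB //.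
by move: xM yM; rewrite !inE => /eqP-> /eqP->; rewrite opprD.
Qed.

(** [AS] is odd and commutes with x^Q, so it maps [M] into itself; injective on a finite set, it is
    onto. *)
Let AS_M_onto (s : F) : s \in M -> exists2 x, x \in M & AS x = s.
Proof.
suff ASM : AS @: M = M by rewrite -{1}ASM => /imsetP[x xM ->]; exists x.
apply/eqP; rewrite eqEcard (card_in_imset AS_M_inj) leqnn andbT.
apply/subsetP=> _ /imsetP[x + ->]; rewrite !inE => /eqP xQ.
by rewrite /AS frobB // exprAC xQ exprNn -signr_odd /= expr1; apply/eqP; ring.
Qed.

(** x - x^Q changes sign under the Frobenius map and is nonzero for x outside [L], which is proper
    because Q < Q^2. *)
Let anti_exists : exists2 c : F, c != 0 & c ^+ Q = - c.
Proof.
have [x xL] : exists x, x \notin L.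
  apply/existsP; rewrite -negb_forall; apply: contraL Q_gt1 => /forallP allL.
  have : #|L| = #|F| by rewrite -cardsT; apply: eq_card => x; rewrite allL inE.
  by rewrite card_L cardF -leqNgt; nia.
exists (x - x ^+ Q); first by move: xL; rewrite inE subr_eq0 eq_sym.
by rewrite frobB // -exprM mulnn -cardF expf_card opprB.
Qed.

(** Each x in [L] is a chosen preimage of [AS x] plus one of the five roots of [AS]. *)
Let card_AS_L : (Q <= #|AS @: L| * 5)%N.
Proof.
pose K := [set x : F | x ^+ 5 == x].
have cardK : #|K| = 5%N by apply: (@card_fixed_exp F 4).
pose s h : F := odflt 0 [pick x : F | (x \in L) && (AS x == h)].
rewrite -cardK -cardsX -{1}card_L.
apply: leq_trans (leq_imset_card (fun z : F * F => s z.1 + z.2) _).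
apply/subset_leq_card/subsetP=> x xL; apply/imsetP; exists (AS x, x - s (AS x)).
  rewrite in_setX imset_f //= inE -subr_eq0 -/(AS _) ASB subr_eq0.
  by rewrite /s; case: pickP => [y /andP[_ /eqP ->] //|/(_ x)]; rewrite xL eqxx.
by rewrite /= addrC subrK.
Qed.

(** The target c y^2 splits into c u^2 + c^3 v^2, which lies in [M] and is always a value of [AS],
    and 2 c^2 u v, which is one by the condition in [T]. The fibre contains a coset of the five
    roots of [AS]. *)
Lemma fibres_Artin_Schreier : exists (g : {poly F}) (Y : {set F}),
  [/\ size g = 6%N, {in Y, forall y, 5 <= #|[set x | g.[x] == y ^+ 2]|}%N
    & (Q ^ 2 + 4 * Q <= 5 * #|Y|)%N].
Proof.
have [c c0 cQ] := anti_exists.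
pose e := 2%:R * c ^+ 2; have e0 : e != 0 by rewrite mulf_neq0 ?expf_neq0.
have eQ : e ^+ Q = e by rewrite /e mulr_natl mulr2n frobD -exprAC cQ sqrrN.
have LM (x y : F) : x \in L -> y \in L -> x * y \in L.
  by rewrite !inE exprMn => /eqP-> /eqP->.
have LV (x : F) : x \in L -> x^-1 \in L by rewrite !inE exprVn => /eqP->.
have L0 : 0 \in L by rewrite inE expr0n eqn0Ngt ltnW.
have AS_L x : x \in L -> AS x \in L.
  by rewrite !inE /AS frobB // exprAC => /eqP->.
pose T := [set z in setX L L | e * z.1 * z.2 \in AS @: L].
pose phi (z : F * F) := z.1 + z.2 * c.
have phi_inj : {in T &, injective phi}.
  move=> [u v] [u' v']; rewrite !inE /= => /andP[/andP[/eqP uL /eqP vL] _].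
  case/andP=> /andP[/eqP u'L /eqP v'L] _ eq_phi.
  have uv : u - u' = (v' - v) * c.
    by apply/eqP; rewrite -subr_eq0; apply/eqP; move: eq_phi => /eqP;
       rewrite /phi /= -subr_eq0 => /eqP <-; ring.
  (* The difference lies in [L], and in [M] by its expression (v' - v) c. *)
  have u0 : u - u' = 0.
    apply: LM_eq0; first by rewrite inE frobB // uL u'L.
    by rewrite inE uv exprMn frobB // v'L vL cQ mulrN.
  move/eqP: u0 (uv); rewrite subr_eq0 => /eqP <-; rewrite subrr => /esym/eqP.
  by rewrite mulf_eq0 (negPf c0) orbF subr_eq0 => /eqP ->.
pose g : {poly F} := c^-1 *: ('X^5 - 'X).
have g_eval x : g.[x] = c^-1 * AS x by rewrite hornerZ hornerD hornerN hornerXn hornerX.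
exists g, (phi @: T); split.
- by rewrite size_scale ?invr_eq0 // size_polyDl size_polyXn ?size_polyN ?size_polyX.
- move=> _ /imsetP[[u v] + ->]; rewrite !inE /=.
  case/andP=> /andP[/eqP uL /eqP vL] /imsetP[w wL def_w].
  have sM : c * u ^+ 2 + c ^+ 3 * v ^+ 2 \in M.
    rewrite inE frobD (exprMn _ c) (exprMn _ (c ^+ 3)) (exprAC u) (exprAC v) (exprAC c).
    rewrite uL vL cQ.
    by apply/eqP; ring.
  have [z zM def_z] := AS_M_onto sM.
  have ASzw : AS (z + w) = c * (u + v * c) ^+ 2.
    by rewrite ASD def_z -def_w /e; ring.
  rewrite -[X in (X <= _)%N](@card_fixed_exp F 4 dvd4F).
  rewrite -(card_imset _ (addrI (z + w))); apply/subset_leq_card/subsetP.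
  move=> _ /imsetP[k + ->]; rewrite !inE g_eval ASD ASzw => /eqP k5.
  by rewrite /AS k5 subrr addr0 mulKf.
rewrite (card_in_imset phi_inj).
(* [T] is counted by u: for u = 0 every v is allowed ([T0]); for u nonzero, [psi] recovers v from h
   = e u v in the image of [AS] on [L]. *)
pose T0 := setX [set (0 : F)] L.
pose D := setX (L :\ 0) (AS @: L).
pose psi (z : F * F) := (z.1, z.2 / (e * z.1)).
have psi_inj : {in D &, injective psi}.
  move=> [u h] [u' h']; rewrite !in_setX !in_setD1 /= => /andP[/andP[u0 _] _] _.
  case=> <- /(congr1 (fun x => x * (e * u))) /=.
  by rewrite !divfK ?mulf_neq0 // => ->.
have disj : [disjoint T0 & psi @: D].
  rewrite -setI_eq0; apply/eqP/setP=> -[u v]; rewrite !inE /=; apply/negP.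
  case/andP=> /andP[/eqP-> _] /imsetP[[u' h]]; rewrite !inE /=.
  by case/andP=> /andP[/negPf u'0 _] _ [/eqP]; rewrite eq_sym u'0.
have cardT : (Q + (Q - 1) * #|AS @: L| <= #|T|)%N.
  have -> : (Q + (Q - 1) * #|AS @: L|
      = #|T0 :|: psi @: D|)%N.
    rewrite cardsU (disjoint_setI0 disj) cards0 subn0 (card_in_imset psi_inj).
    rewrite !cardsX cards1 mul1n card_L.
    by have := cardsD1 0 L; rewrite L0 card_L => eqQ; rewrite [in (Q - 1)%N]eqQ addKn.
  apply/subset_leq_card/subsetP=> -[u v]; rewrite in_setU => /orP[].
    rewrite !inE /= => /andP[/eqP-> vL]; rewrite vL mulr0 mul0r.
    rewrite expr0n eqn0Ngt ltnW //= eqxx /=; apply/imsetP; exists 0 => //.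
    by rewrite /AS expr0n subr0.
  case/imsetP=> -[u' h]; rewrite in_setX in_setD1 /= => /andP[/andP[u0 uL] hA] [-> ->].
  rewrite inE in_setX /= uL [e * u' * _]mulrC divfK ?mulf_neq0 // hA andbT.
  have [w wL ->] := imsetP hA; apply: (LM); first exact: AS_L.
  by apply/LV/LM; rewrite // inE eQ.
(* 5 |T| >= 5Q + (Q - 1) Q = Q^2 + 4Q. *)
have := card_AS_L; move: cardT; move: #|AS @: L| #|T| => h n; nia.
Qed.

End ArtinSchreier.

(** * Choice of the curve and comparison with the bound on l *)

Theorem mainTheorem8 (p a : nat) (F : finFieldType) :
  prime p -> odd p -> odd a -> (0 < a)%N ->
  #|F| = (p ^ (2 * a))%N ->
  (p %% 5 = 4)%N \/ p = 5%N ->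
  forall t l : nat, (t < l)%N ->
    (l <= (p ^ (2 * a) + 4 * p ^ a - 11) %/ 5)%N ->
  exists (C : {vspace 'rV[F]_(5 * l)}) (d : nat),
    [/\ \dim C = (4 * t + 1)%N,
        has_locality C 4,
        is_min_dist C d,
        (5 * l - 5 * t - 1 <= d)%N &
        (defect (5 * l) (4 * t + 1) 4 d <= 1)%R].
Proof.
move=> p_prime p_odd a_odd a_gt0 cardF p5 t l lt_tl.
have pcharp : p \in [pchar F] by apply: card_finPcharP cardF p_prime.
have two0 : 2%:R != 0 :> F.
  rewrite -(dvdn_pcharf pcharp); apply: contraL p_odd => /dvdn_leq /= /(_ isT).
  by case: p p_prime {cardF p5 pcharp} => [|[|[|]]].
have sqrQ : (p ^ (2 * a) = (p ^ a) ^ 2)%N by rewrite mulnC expnM.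
rewrite sqrQ in cardF *; have pcharQ : [pchar F].-nat (p ^ a)%N.
  by rewrite pnatX pnatE // pcharp.
have Q_gt1 : (1 < p ^ a)%N by rewrite -(exp1n a) ltn_exp2r // prime_gt1.
case: p5 => [p4 | eqp5] le_l.
  (* The odd exponent keeps -1 modulo 5; as Q is odd too, 10 divides Q + 1. *)
  have Q4 : (p ^ a %% 5 = 4)%N.
    rewrite -modnXm p4 -(odd_double_half a) a_odd expnD -mul2n expnM.
    by rewrite -modnMmr -modnXm exp1n.
  have Q_odd : odd (p ^ a) by rewrite oddX p_odd orbT.
  have Q10 : (p ^ a + 1 = 10 * ((p ^ a + 1) %/ 10))%N by lia.
  have [g [Y [szg fibreY cardY]]] := fibres_X5_add1 pcharQ Q_gt1 cardF Q10 two0.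
  apply: lrc_of_fibres two0 szg fibreY lt_tl _; apply: leq_trans cardY.
  apply: leq_trans le_l _; move: Q10; move: ((p ^ a + 1) %/ 10)%N => m Q10.
  have -> : (p ^ a = 10 * m - 1)%N by lia.
  case: m Q10 => [|m] Q10; first by lia.
  rewrite (_ : 10 * m.+1 - 1 = 10 * m + 9)%N; last by lia.
  (* With Q = 10M - 1, here M = [m.+1], the bound on l is 20M^2 + 4M - 3, one below the number of
     full fibres guaranteed. *)
  have -> : ((10 * m + 9) ^ 2 + 4 * (10 * m + 9) - 11
             = (20 * m.+1 ^ 2 + 4 * m.+1 - 3) * 5 + 1)%N by nia.
  by rewrite divnMDl //; lia.
have dvd4 : (4 %| p ^ a - 1)%N.
  by have := subn_exp 5 1 a; rewrite eqp5 exp1n => ->; rewrite dvdn_mulr.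
rewrite eqp5 in pcharp.
have [g [Y [szg fibreY cardY]]] := fibres_Artin_Schreier pcharQ Q_gt1 cardF pcharp dvd4.
apply: lrc_of_fibres two0 szg fibreY lt_tl _; apply: leq_trans le_l _.
by move: cardY; move: #|Y| ((p ^ a) ^ 2 + 4 * p ^ a)%N => y x; lia.
Qed.
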